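(* Let $\Gamma:B\to B$ satisfy (a), (b), (c) of the context. Assume that (i) for some $\mu_*\in\mathbb{R}$ there exists a classical solution $w$ (continuously differentiable if $\mu_*\ne0$) of $$\mu_*\,x\,w'(x)+w(x)=\Gamma(w)(x),\qquad \|w\|\le1;$$ (ii) the initial datum $u_0$ of the problem $u_t+u=\Gamma(u)$, $u|_{t=0}=u_0$, satisfies $$u_0=w+O(x^p),\qquad\|u_0\|\le1,\qquad\text{for some }p>0\text{ such that }\mu(p)<\mu_*.$$ Then the solution $u(x,t)$ satisfies $$|u(xe^{-\mu_*t},t)-w(x)|=O(x^p)\,e^{-pt(\mu_*-\mu(p))},$$ i.e. there is a constant $C$ such that the left-hand side is at most $Cx^pe^{-pt(\mu_*-\mu(p))}$ for all $x\ge0$, $t\ge0$, and therefore $$\lim_{t\to\infty}u(xe^{-\mu_*t},t)=w(x),\qquad x\ge0.$$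
   Context: $\mathbb{R}_+=[0,\infty)$; $B=C(\mathbb{R}_+)$ is the Banach space of bounded continuous real-valued functions on $\mathbb{R}_+$ with the sup norm; $U=\{u\in B:\|u\|\le1\}$. The conditions are: (a) $\Gamma(U)\subset U$. (b) $\Gamma$ is $L$-Lipschitz: for all $u_1,u_2\in U$ and all $x\ge0$, $|\Gamma(u_1)-\Gamma(u_2)|(x)\le L(|u_1-u_2|)(x)$, where $Lu(x)=\int_0^\infty da\,K(a)u(ax)$ and $K\ge0$ is a generalized function (i.e. $K(a)da$ is a finite nonnegative Borel measure on $\mathbb{R}_+$) such that $0<\lambda(p):=\int_0^\infty da\,K(a)a^p<\infty$ for all $p\ge0$. (c) $\Gamma$ is invariant under dilations: for every $\tau\in\mathbb{R}$, $\Gamma(u(e^\tau\,\cdot))=\Gamma(u)(e^\tau\,\cdot)$. The spectral function is $\mu(p)=(\lambda(p)-1)/p$, $p>0$. The notation $y=O(x^p)$ means that there is a constant $C>0$ with $|y(x)|\le Cx^p$ for all $x\ge0$. A classical solution $w$ is a function in $B$ which, if $\mu_*\neq0$, is continuously differentiable on $(0,\infty)$ and satisfies the equation for $x>0$ (if $\mu_*=0$ the equation is $w=\Gamma(w)$). The solution $u(x,t)$ of the Cauchy problem with $\|u_0\|\le1$ is the unique continuously differentiable map $t\mapsto u(\cdot,t)\in B$, $t\ge0$, with $\|u(\cdot,t)\|\le1$ satisfying the equation and the initial condition. *)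

(* Defs.v *)
From HB Require Import structures.
From mathcomp Require Import all_boot all_order all_algebra.
From mathcomp Require Import all_classical all_reals all_analysis.
From mathcomp Require Import lra.

Set Implicit Arguments.
Unset Strict Implicit.
Unset Printing Implicit Defensive.
Import Order.TTheory GRing.Theory Num.Theory.
Import numFieldNormedType.Exports.
Local Open Scope classical_set_scope.
Local Open Scope ring_scope.

(* The Banach space [bcfun R] of bounded continuous functions on [0, +oo[.
   A function on the half-line is represented by its extension by 0 to R, so
   that Leibniz equality in [bcfun R] is equality on [0, +oo[. *)
Definition bcfun_axiom (R : realType) (f : R -> R) : Prop :=
  [/\ {within `[0, +oo[, continuous f},
      exists M : R, forall x, 0 <= x -> `|f x| <= M
    & forall x, x < 0 -> f x = 0].

Definition bcfun_pred (R : realType) : {pred R -> R} :=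
  mem [set f : R -> R | bcfun_axiom f].

Record bcfun (R : realType) := Bcfun {
  bcfun_val :> R -> R;
  bcfun_valP : bcfun_val \in @bcfun_pred R }.

HB.instance Definition _ (R : realType) := [isSub for @bcfun_val R].
HB.instance Definition _ (R : realType) := [Choice of bcfun R by <:].

Section bcfun_theory.
Variable R : realType.
Implicit Types (f g : bcfun R) (x : R).

Lemma bcfun_continuous f : {within `[0, +oo[, continuous f}.
Proof. by have := bcfun_valP f; rewrite inE => -[]. Qed.

Lemma bcfun_bounded f : exists M : R, forall x, 0 <= x -> `|f x| <= M.
Proof. by have := bcfun_valP f; rewrite inE => -[]. Qed.

Lemma bcfun_neg f x : x < 0 -> f x = 0.
Proof. by have := bcfun_valP f; rewrite inE => -[_ _]; exact. Qed.

Lemma bcfun_submod_closed : submod_closed (@bcfun_pred R).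
Proof.
split; rewrite ?inE.
  split => //; first by apply: continuous_subspaceT => x; exact: cvg_cst.
  by exists 0 => x _; rewrite normr0.
move=> a f g; rewrite !inE => -[cf [M Mf] f0] [cg [N Ng] g0]; split.
- by move=> x; apply: cvgD; [apply: cvgZl_tmp; exact: cf|exact: cg].
- exists (`|a| * M + N) => x x0.
  rewrite (le_trans (ler_normD _ _))// lerD ?Ng//.
  by rewrite normrM ler_wpM2l// Mf.
- by move=> x x0; rewrite /= -[LHS]/(a * f x + g x) f0// g0// mulr0 addr0.
Qed.

HB.instance Definition _ :=
  GRing.isSubmodClosed.Build _ _ (@bcfun_pred R) bcfun_submod_closed.
HB.instance Definition _ := [SubChoice_isSubLmodule of bcfun R by <:].

Lemma bcfunP f g : (forall x, 0 <= x -> f x = g x) -> f = g.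
Proof.
move=> fg; apply/val_inj/funext => x /=.
by have [/fg//|x0] := leP 0 x; rewrite !bcfun_neg.
Qed.

Lemma bcfunDE f g x : (f + g) x = f x + g x. Proof. by []. Qed.

Lemma bcfunBE f g x : (f - g) x = f x - g x. Proof. by []. Qed.

Lemma bcfunZE (a : R) f x : (a *: f) x = a * f x. Proof. by []. Qed.

Definition bcfun_norm f : R := sup [set `|f x| | x in `[0, +oo[].

Lemma bcfun_norm_has_sup f : has_sup [set `|f x| | x in `[0, +oo[].
Proof.
split; first by exists `|f 0|, 0 => //=; rewrite in_itv/= lexx.
have [M Mf] := bcfun_bounded f; exists M => y [x] /=.
by rewrite in_itv/= andbT => x0 <-; exact: Mf.
Qed.

Lemma bcfun_norm_ub f x : 0 <= x -> `|f x| <= bcfun_norm f.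
Proof.
move=> x0; apply: ub_le_sup; first by case: (bcfun_norm_has_sup f).
by exists x => //=; rewrite in_itv/= x0.
Qed.

Lemma bcfun_norm_le f (M : R) :
  (forall x, 0 <= x -> `|f x| <= M) -> bcfun_norm f <= M.
Proof.
move=> fM; apply: ge_sup; first by case: (bcfun_norm_has_sup f).
by move=> y [x] /=; rewrite in_itv/= andbT => x0 <-; exact: fM.
Qed.

Lemma bcfun_norm_ge0 f : 0 <= bcfun_norm f.
Proof. exact: le_trans (bcfun_norm_ub f (lexx 0)). Qed.

Lemma bcfun_ler_normD f g : bcfun_norm (f + g) <= bcfun_norm f + bcfun_norm g.
Proof.
apply: bcfun_norm_le => x x0; rewrite bcfunDE (le_trans (ler_normD _ _))//.
by rewrite lerD// bcfun_norm_ub.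
Qed.

Lemma bcfun_normrZ (a : R) f : bcfun_norm (a *: f) = `|a| * bcfun_norm f.
Proof.
have le b h : bcfun_norm (b *: h) <= `|b| * bcfun_norm h.
  apply: bcfun_norm_le => x x0; rewrite bcfunZE normrM.
  by rewrite ler_wpM2l// bcfun_norm_ub.
apply/eqP; rewrite eq_le le /=.
have [->|a0] := eqVneq a 0; first by rewrite normr0 mul0r bcfun_norm_ge0.
rewrite -ler_pdivlMl ?normr_gt0// -normfV (le_trans _ (le _ _))//.
by rewrite scalerA mulVf// scale1r.
Qed.

Lemma bcfun_normr0_eq0 f : bcfun_norm f = 0 -> f = 0.
Proof.
move=> f0; apply: bcfunP => x x0; apply/eqP; rewrite -normr_le0 -f0.
exact: bcfun_norm_ub.
Qed.

HB.instance Definition _ := Lmodule_isNormed.Build R (bcfun R)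
  bcfun_ler_normD bcfun_normrZ bcfun_normr0_eq0.

Lemma bcfun_normE f : `|f| = sup [set `|f x| | x in `[0, +oo[].
Proof. by []. Qed.

Lemma bcfun_ler_norm f x : 0 <= x -> `|f x| <= `|f|.
Proof. exact: bcfun_norm_ub. Qed.

Lemma bcfun_complete (F : set_system (bcfun R)) :
  ProperFilter F -> cauchy F -> cvg F.
Proof.
move=> FF Fc.
have lebB f g x : `|f x - g x| <= `|f - g|.
  rewrite -bcfunBE; have [x0|x0] := leP 0 x; first exact: bcfun_ler_norm.
  by rewrite bcfun_neg// normr0 normr_ge0.
have Fe (e : R) : 0 < e -> exists f, \forall g \near F, `|f - g| < e.
  move=> e0; have /cauchyP/(_ e e0)[f Ff] := Fc; exists f.
  by move: Ff; rewrite -ball_normE.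
have Fx x : cvg ((fun f : bcfun R => f x) @ F).
  apply: cauchy_cvg; apply/cauchyP => e /Fe[f Ff]; exists (f x).
  rewrite -ball_normE /=; apply: filterS Ff => g.
  exact: le_lt_trans (lebB _ _ _).
pose l x := lim ((fun f : bcfun R => f x) @ F).
have Fl (e : R) : 0 < e -> \forall f \near F, forall x, `|bcfun_val f x - l x| <= e.
  move=> e0; have [f Ff] := Fe _ (divr_gt0 e0 (ltr0n _ 2)).
  apply: filterS (Ff) => g fg x.
  have lf : `|f x - l x| <= e / 2.
    have cl : (fun h : bcfun R => `|f x - h x|) @ F --> `|f x - l x|.
      by apply: cvg_norm; apply: cvgB; [exact: cvg_cst|exact: Fx].
    apply: (cvgr_to_le cl).
    by apply: filterS Ff => h /ltW; exact: le_trans (lebB _ _ _).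
  have := lebB f g x; rewrite distrC => gf.
  have -> : g x - l x = (g x - f x) + (f x - l x) by lra.
  by rewrite (le_trans (ler_normD _ _))// (splitr e) lerD// (le_trans gf)// ltW.
have lP : l \in @bcfun_pred R.
  rewrite inE; split.
  - apply/subspace_continuousP => x x0; apply/cvgrPdist_le => e e0.
    near F => f.
    have fl : forall x, `|f x - l x| <= e / 3.
      by near: f; apply: Fl; rewrite divr_gt0.
    have /subspace_continuousP/(_ x x0)/cvgrPdist_le/(_ (e / 3)) :=
      @bcfun_continuous f.
    rewrite divr_gt0// => /(_ isT); apply: filterS => y fxy.
    have -> : l x - l y = (f x - f y) - (f x - l x) + (f y - l y) by lra.
    rewrite (le_trans (ler_normD _ _))//.
    have := ler_normB (f x - f y) (f x - l x).
    by move: (fl x) (fl y); lra.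
  - near F => f; have [M Mf] := bcfun_bounded f; exists (M + 1) => x x0.
    have -> : l x = f x - (f x - l x) by lra.
    rewrite (le_trans (ler_normB _ _))// lerD ?Mf//.
    by move: x {x0}; near: f; exact: Fl.
  - move=> x x0; apply/cvg_lim => //.
    under eq_cvg do rewrite bcfun_neg//.
    exact: cvg_cst.
apply/cvg_ex; exists (Bcfun lP); apply/cvgrPdist_le => e e0.
apply: filterS (Fl e e0) => f fl; apply: bcfun_norm_le => x x0.
by rewrite bcfunBE distrC; exact: fl.
Unshelve. all: by end_near. Qed.

HB.instance Definition _ :=
  Uniform_isComplete.Build (bcfun R) bcfun_complete.

End bcfun_theory.

(* The dilation u |-> u(e^tau .) *)
Section dilate.
Variables (R : realType) (tau : R) (u : bcfun R).

Lemma dilate_subproof : (fun x => u (expR tau * x)) \in @bcfun_pred R.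
Proof.
rewrite inE; split.
- apply/subspace_continuousP => x; rewrite /= in_itv/= andbT => x0.
  have /subspace_continuousP /(_ (expR tau * x)) := @bcfun_continuous _ u.
  rewrite /= in_itv/= andbT mulr_ge0 ?expR_ge0// => /(_ isT) cu.
  apply: (@cvg_comp _ _ _ (fun z => expR tau * z) u _ _ _ _ cu) => A.
  move=> /(@mulrl_continuous _ (expR tau) x) xA.
  rewrite nbhs_filterE in xA; rewrite nbhs_filterE.
  apply: (@filterS _ (nbhs x) _ _ _ _ xA) => z zA.
  rewrite /= in_itv/= andbT => z0; apply: zA.
  by rewrite /= in_itv/= andbT mulr_ge0 ?expR_ge0.
- have [M Mu] := bcfun_bounded u; exists M => x x0.
  by rewrite Mu// mulr_ge0 ?expR_ge0.
- by move=> x x0; rewrite bcfun_neg// pmulr_rlt0 ?expR_gt0.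
Qed.

Definition dilate : bcfun R := Bcfun dilate_subproof.

End dilate.

Section Defs.
Variable R : realType.

(* The measure K(a) da; only its restriction to [0, +oo[ is ever used. *)
Variable K : {finite_measure set (measurableTypeR R) -> \bar R}.

Definition Lop (v : R -> R) (x : R) : R :=
  (\int[K]_(a in `[0%R, +oo[) v (a * x))%R.

(* Since [0 `^ 0 = 1], [lambda 0] is the total mass of K on [0, +oo[. *)
Definition lambda (p : R) : \bar R :=
  (\int[K]_(a in `[0%R, +oo[) (a `^ p)%:E)%E.

Definition mu (p : R) : R := (fine (lambda p) - 1) / p.

Variable Gamma : bcfun R -> bcfun R.

Definition preserves_unit_ball : Prop :=
  forall u, `|u| <= 1 -> `|Gamma u| <= 1.

Definition L_Lipschitz : Prop :=
  forall u1 u2, `|u1| <= 1 -> `|u2| <= 1 -> forall x, 0 <= x ->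
    `|Gamma u1 x - Gamma u2 x| <= Lop (fun y => `|u1 y - u2 y|) x.

Definition dilation_invariant : Prop :=
  forall (tau : R) u, Gamma (dilate tau u) = dilate tau (Gamma u).

Definition classical_solution (m : R) (w : bcfun R) : Prop :=
  if m == 0 then w = Gamma w
  else [/\ forall x, 0 < x -> derivable w x 1,
           {in `]0, +oo[, continuous (derive1 w)}
         & forall x, 0 < x -> m * x * derive1 w x + w x = Gamma w x].

(* [v] is the derivative of [u : [0, +oo[ -> V] at [t], as a limit in [V] of
   difference quotients inside [0, +oo[ (hence one-sided at [t = 0]). *)
Definition is_derive_ge0 (V : normedModType R) (u : R -> V) (t : R) (v : V) :=
  h^-1 *: (u (h + t) - u t) @[h --> within [set h | 0 <= h + t] 0^'] --> v.

(* [u t] is u(., t), only its values for [t >= 0] are constrained; [u'] is the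
   derivative u_t, taken in the Banach space [bcfun R]. *)
Definition cauchy_solution (u0 : bcfun R) (u : R -> bcfun R) : Prop :=
  [/\ u 0 = u0,
      forall t, 0 <= t -> `|u t| <= 1
    & exists u' : R -> bcfun R,
      [/\ forall t, 0 <= t -> is_derive_ge0 u t (u' t),
          {within `[0, +oo[, continuous u'}
        & forall t, 0 <= t -> u' t + u t = Gamma (u t)]].

End Defs.

Definition bigO_pow (R : realType) (p : R) (y : R -> R) : Prop :=
  exists2 C : R, 0 < C & forall x, 0 <= x -> `|y x| <= C * x `^ p.

(* Main.v *)
(* Put d(x,t) = u(x,t) - w(x e^(mustar t)).  By dilation invariance the second
   term solves the same equation as u pointwise at every x > 0, so
   phi = e^t d satisfies |phi_t(x,t)| <= \int K(a) |phi(ax,t)| da there.  On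
   [0,T] one has |phi| <= 2 e^T, and n rounds of integration in time, using
   \int K(a) (ax)^p da = lambda(p) x^p, give
     |phi(x,t)| <= C x^p e^(lambda(p) t) + 2 e^T (lambda(0) t)^n / n!.
   The remainder vanishes as n -> oo, and substituting x e^(-mustar t) for x
   turns e^((lambda(p) - 1) t) x^p into the stated rate.  Bounds at x = 0, where
   w need not be differentiable, follow from those at x > 0 by continuity. *)
Require Import Defs.
From HB Require Import structures.
From mathcomp Require Import all_boot all_order all_algebra.
From mathcomp Require Import all_classical all_reals all_analysis.
From mathcomp Require Import measurable_realfun.
From mathcomp Require Import ring lra.
Import Order.TTheory GRing.Theory Num.Theory.
Import numFieldNormedType.Exports.
Local Open Scope classical_set_scope.
Local Open Scope ring_scope.

(** * Comparison and differentiation in time *)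

(** Both [F + f] and [F - f] have nonnegative derivative on the open interval, hence are
    nondecreasing. At the endpoint 0 only continuity is asked, since the solution has just a
    one-sided derivative there. *)
Lemma le_norm_of_derive (R : realType) (f F f' F' : R -> R) (T : R) :
  {within `[0, T], continuous f} -> {within `[0, T], continuous F} ->
  (forall t : R, 0 < t -> is_derive t 1 f (f' t)) ->
  (forall t : R, 0 < t -> is_derive t 1 F (F' t)) ->
  (forall t : R, 0 < t -> t < T -> `|f' t| <= F' t) ->
  `|f 0| <= F 0 ->
  forall t : R, 0 <= t -> t <= T -> `|f t| <= F t.
Proof.
move=> cf cF df dF f'F' f0F0 t t0 tT.
have t0T : t \in `[0, T] by rewrite in_itv/= t0.
have z0T : 0 \in `[0, T] by rewrite in_itv/= lexx (le_trans t0 tT).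
have dFDf (s : R) : 0 < s -> is_derive s 1 (F + f) (F' s + f' s).
  by move=> s0; have := dF _ s0; have := df _ s0 => ? ?; exact: is_deriveD.
have dFBf (s : R) : 0 < s -> is_derive s 1 (F - f) (F' s - f' s).
  by move=> s0; have := dF _ s0; have := df _ s0 => ? ?; exact: is_deriveB.
have : (F + f) 0 <= (F + f) t.
  apply: (@ger0_derive1_le_cc _ _ 0 T) => //.
  - by move=> s; rewrite in_itv/= => /andP[/dFDf[]].
  - move=> s; rewrite in_itv/= => /andP[s0 sT]; rewrite derive1E.
    have [_ ->] := dFDf _ s0; have := f'F' _ s0 sT.
    by rewrite ler_norml => /andP[]; lra.
  - by move=> s; apply: cvgD; [exact: cF|exact: cf].
have : (F - f) 0 <= (F - f) t.
  apply: (@ger0_derive1_le_cc _ _ 0 T) => //.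
  - by move=> s; rewrite in_itv/= => /andP[/dFBf[]].
  - move=> s; rewrite in_itv/= => /andP[s0 sT]; rewrite derive1E.
    have [_ ->] := dFBf _ s0; have := f'F' _ s0 sT.
    by rewrite ler_norml => /andP[]; lra.
  - by move=> s; apply: cvgB; [exact: cF|exact: cf].
move: f0F0; rewrite !ler_norml => /andP[? ?].
by rewrite -![(F - f) _]/(F _ - f _) -![(F + f) _]/(F _ + f _); lra.
Qed.

Lemma cvg_bcfun_apply (R : realType) (T : Type) (F : set_system T)
    (FF : Filter F) (g : T -> bcfun R) (l : bcfun R) (x : R) :
  g @ F --> l -> g s x @[s --> F] --> l x.
Proof.
move=> /cvgrPdist_le gl; apply/cvgrPdist_le => e /gl; apply: filterS => s.
apply: le_trans; rewrite -bcfunBE; have [x0|x0] := leP 0 x.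
  exact: bcfun_ler_norm.
by rewrite bcfun_neg// normr0.
Qed.

(** For [t > 0] the constraint [0 <= h + t] holds for all small [h], so the restricted filter gives
    a two-sided limit; evaluation at a point is 1-Lipschitz for the sup norm. *)
Lemma is_derive_ge0_apply (R : realType) (u : R -> bcfun R) (t : R)
    (v : bcfun R) (x : R) :
  0 < t -> is_derive_ge0 u t v -> is_derive t 1 (fun s => u s x) (v x).
Proof.
move=> t0 uv.
have FF : Filter (within [set h | 0 <= h + t] (0 : R)^') by exact: within_filter.
have /= uvx := @cvg_bcfun_apply _ _ _ FF _ _ x uv.
suff H : h^-1 *: (((fun s => u s x) \o shift t) (h *: 1) - u t x)
    @[h --> 0^'] --> v x.
  by apply: DeriveDef; [apply/cvg_ex; exists (v x)|exact: cvg_lim].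
apply/cvgrPdist_le => e e0; move/cvgrPdist_le : uvx => /(_ e e0).
rewrite near_withinE => H; near=> h.
have ht : 0 <= h + t.
  near: h; apply: nbhs_dnbhs; exists t => // h /=.
  by rewrite sub0r normrN => /ltr_normlP[]; lra.
suff -> : h^-1 *: (((fun s => u s x) \o shift t) (h *: 1) - u t x) =
   (h^-1 *: (u (h + t) - u t)) x by move: ht; near: h; exact: H.
by rewrite [RHS]bcfunZE bcfunBE /= -[h *: 1]/(h * 1) mulr1.
Unshelve. all: by end_near. Qed.

(** At time 0 only right-hand quotients are available; continuity comes from writing [u h x] as [h]
    times the quotient plus [u 0 x]. *)
Lemma is_derive_ge0_cvg0 (R : realType) (u : R -> bcfun R) (v : bcfun R) (x : R) :
  is_derive_ge0 u 0 v -> u t x @[t --> 0^'+] --> u 0 x.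
Proof.
move=> uv.
have FF : Filter (within [set h | 0 <= h + 0] (0 : R)^') by exact: within_filter.
have /= uvx := @cvg_bcfun_apply _ _ _ FF _ _ x uv.
have {}uvx : (h^-1 *: (u (h + 0) - u 0)) x @[h --> 0^'+] --> v x.
  apply/cvgrPdist_le => e e0; move/cvgrPdist_le : uvx => /(_ e e0).
  rewrite !near_withinE; apply: filterS => h + h0; apply.
    by rewrite gt_eqF.
  by rewrite /= addr0 ltW.
have id0 : (h : R) @[h --> 0^'+] --> (0 : R).
  by apply: cvg_at_right_filter; exact: cvg_id.
have uvx0 : h * (h^-1 *: (u (h + 0) - u 0)) x + u 0 x @[h --> 0^'+] --> u 0 x.
  rewrite -[X in _ --> X]add0r -[X in _ --> X + _](mul0r (v x)).
  by apply: cvgD; [exact: cvgM|exact: cvg_cst].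
apply: cvg_trans uvx0; apply: near_eq_cvg.
near=> h.
have h0 : h != 0 by rewrite gt_eqF//; near: h; exact: nbhs_right_gt.
by rewrite bcfunZE bcfunBE addr0 mulrA divff ?mul1r ?subrK//.
Unshelve. all: by end_near. Qed.

Lemma is_derive_expRM (R : realType) (a t : R) :
  is_derive t 1 (fun s : R => expR (a * s)) (a * expR (a * t)).
Proof.
have da : is_derive t 1 (fun s : R => a * s) a.
  have := @is_deriveZ _ _ _ id a t 1 1 _.
  by rewrite -[a *: 1]/(a * 1) mulr1; exact.
rewrite mulrC; exact: (@is_derive1_comp _ expR (fun s => a * s) _ _ _ _ da).
Qed.

(** One time integration raises the index of the remainder term by one in the induction of
    [phi_iter]. *)
Lemma is_derive_exp_coeffM (R : realType) (a : R) (n : nat) (t : R) :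
  is_derive t 1 (fun s : R => exp_coeff (a * s) n.+1) (a * exp_coeff (a * t) n).
Proof.
have -> : (fun s : R => exp_coeff (a * s) n.+1) =
    (a ^+ n.+1 / n.+1`!%:R) *: ((id : R -> R) ^+ n.+1).
  apply/funext => s; rewrite /exp_coeff /= exprMn mulrAC.
  by rewrite -[RHS]/(_ * (id ^+ n.+1) s) exprfctE.
have := @is_deriveZ _ _ _ _ (a ^+ n.+1 / n.+1`!%:R) _ _ _
  (@is_deriveX _ _ _ n.+1 _ _ _ (is_derive_id t 1)).
move=> /is_derive_eq; apply.
rewrite /exp_coeff -![_ *: _]/(_ * _) /= factS natrM invfM exprS exprMn mulr1.
have : (n`!%:R : R) != 0 by rewrite pnatr_eq0 -lt0n fact_gt0.
have : (n.+1%:R : R) != 0 by rewrite pnatr_eq0.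
by move: n.+1%:R n`!%:R => b c b0 c0; field; rewrite b0 c0.
Qed.

(** * The operator L on powers *)

Section Lop.
Variables (R : realType) (K : {finite_measure set (measurableTypeR R) -> \bar R}).
Hypothesis hK : forall p : R, 0 <= p -> (0 < lambda K p < +oo)%E.

Lemma lambda_fineK (p : R) : 0 <= p -> ((fine (lambda K p))%:E = lambda K p)%E.
Proof.
by move=> p0; rewrite fineK// gt0_fin_numE; have /andP[] := hK _ p0.
Qed.

(** Each power is an eigenfunction of L: y^p is sent to lambda(p) x^p. The constant [B] is treated
    as a multiple of the power 0. *)
Lemma Lop_le (v : bcfun R) (p x A B : R) : 0 <= p -> 0 < x -> 0 <= A -> 0 <= B ->
  (forall y, 0 <= y -> `|v y| <= A * y `^ p + B) ->
  Lop K (fun y => `|v y|) x <=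
    fine (lambda K p) * (A * x `^ p) + fine (lambda K 0) * B.
Proof.
move=> p0 x0 A0 B0 vAB.
have mpow (q : R) : measurable_fun (`[0%R, +oo[ : set (measurableTypeR R))
    (fun a : measurableTypeR R => ((a : R) `^ q)%:E).
  apply/measurable_EFinP; apply: measurable_funTS; exact: measurable_powR.
have mI : measurable (`[0%R, +oo[%classic : set (measurableTypeR R)) by [].
rewrite /Lop /Rintegral -lee_fin.
have le1 : (\int[K]_(a in `[0%R, +oo[) (`|v (a * x)%R|)%:E <=
   (fine (lambda K p) * (A * x `^ p) + fine (lambda K 0) * B)%:E)%E.
  have -> : ((fine (lambda K p) * (A * x `^ p) + fine (lambda K 0) * B)%:E =
    \int[K]_(a in `[0%R, +oo[) ((A * x `^ p)%:E * (a `^ p)%:E + B%:E * (a `^ 0)%:E))%E.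
    rewrite ge0_integralD//.
    - rewrite !ge0_integralZl_EFin ?mulr_ge0 ?powR_ge0//.
      + by rewrite EFinD !EFinM !lambda_fineK// muleC [X in (_ + X)%E]muleC.
      + by move=> a _; rewrite lee_fin powR_ge0.
      + by move=> a _; rewrite lee_fin powR_ge0.
    - by move=> a _; rewrite mule_ge0 ?lee_fin ?mulr_ge0 ?powR_ge0.
    - exact: measurable_funeM.
    - by move=> a _; rewrite mule_ge0 ?lee_fin ?mulr_ge0 ?powR_ge0.
    - exact: measurable_funeM.
  apply: ge0_le_integral => //.
  - apply/measurable_EFinP; apply: measurableT_comp => //.
    (* As [x > 0], the map a -> v(a x) is a dilation of [v], hence continuous on the half-line and
       so measurable. *)
    have := @bcfun_continuous _ (dilate (ln x) v).
    move=> /(subspace_continuous_measurable_fun mI).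
    by apply: eq_measurable_fun => a _ /=; rewrite lnK// mulrC.
  - by apply: emeasurable_funD; exact: measurable_funeM.
  - move=> a; rewrite /= in_itv/= andbT => a0.
    rewrite -!EFinM -EFinD lee_fin powRr0 mulr1.
    have := vAB (a * x) (mulr_ge0 a0 (ltW x0)).
    by rewrite powRM ?(ltW x0)//; lra.
(* [Rintegral] takes [fine], which keeps the value only of a finite integral; finiteness follows
   from [le1]. *)
rewrite fineK//; rewrite ge0_fin_numE; first by rewrite (le_lt_trans le1)// ltry.
by apply: integral_ge0 => a _; rewrite lee_fin.
Qed.

End Lop.

(** * Dilations and the self-similar solution *)

Lemma dilateE (R : realType) (tau : R) (u : bcfun R) x :
  dilate tau u x = u (expR tau * x).
Proof. by []. Qed.

Lemma norm_dilate_le (R : realType) (tau : R) (u : bcfun R) : `|dilate tau u| <= `|u|.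
Proof.
apply: bcfun_norm_le => x x0; rewrite dilateE.
by rewrite bcfun_ler_norm// mulr_ge0// expR_ge0.
Qed.

(** With y = x e^(m t), the chain rule gives m y w'(y), which the profile equation turns into
    Gamma(w)(y) - w(y); dilation invariance does the rest. If [m = 0], [w] need not be
    differentiable, but the orbit is constant. *)
Lemma classical_solution_derive (R : realType) (Gamma : bcfun R -> bcfun R)
    (m : R) (w : bcfun R) (x t : R) :
  dilation_invariant Gamma -> classical_solution Gamma m w -> 0 < x ->
  is_derive t 1 (fun s => dilate (m * s) w x)
    (Gamma (dilate (m * t) w) x - dilate (m * t) w x).
Proof.
move=> hc; rewrite /classical_solution; case: ifPn => [/eqP -> ew|m0 [dw _ ew]] x0.
  have -> : (fun s : R => dilate (0 * s) w x) = cst (w x).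
    by apply/funext => s; rewrite dilateE mul0r expR0 mul1r.
  rewrite hc -ew subrr; exact: is_derive_cst.
rewrite hc !dilateE.
set y := expR (m * t) * x; have y0 : 0 < y by rewrite mulr_gt0 ?expR_gt0.
rewrite -(ew _ y0) addrK.
have dy : is_derive t 1 (fun s => expR (m * s) * x) (m * y).
  have := @is_deriveM _ _ (fun s => expR (m * s)) (cst x) t 1 _ _
    (is_derive_expRM _ m t) (is_derive_cst _ _ _).
  by move=> /is_derive_eq; apply; rewrite /cst/= scaler0 add0r -[LHS]/(_ * _) /y; ring.
have dwy : is_derive y 1 w (derive1 w y).
  by rewrite derive1E; apply: derivableP; exact: dw.
have := @is_derive1_comp _ w (fun s => expR (m * s) * x) t _ _ dwy dy.
by rewrite mulrC.
Qed.

Lemma bcfun_le_pow0 (R : realType) (v : bcfun R) (A B p : R) : 0 < p ->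
  (forall x, 0 < x -> `|v x| <= A * x `^ p + B) ->
  forall x, 0 <= x -> `|v x| <= A * x `^ p + B.
Proof.
move=> p0 vAB x; rewrite le_eqVlt => /orP[/eqP <-|]; last exact: vAB.
have /continuous_within_itvcyP[_ v0] := @bcfun_continuous _ v.
apply: (@ler_cvg_to _ (0 : R)^'+ _ _ (fun y => `|v y|) (fun y => A * y `^ p + B)).
- exact: cvg_norm.
- apply: cvgD; last exact: cvg_cst.
  rewrite powR0 ?gt_eqF//; apply: cvgMl_tmp; exact: powR_cvg0.
- by near=> y; apply: vAB; near: y; exact: nbhs_right_gt.
Unshelve. all: by end_near. Qed.

(** * The iterated estimate *)

Section convergence.
Variables (R : realType) (K : {finite_measure set (measurableTypeR R) -> \bar R}).
Hypothesis hK : forall p : R, 0 <= p -> (0 < lambda K p < +oo)%E.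
Variable Gamma : bcfun R -> bcfun R.
Hypotheses (hb : L_Lipschitz K Gamma) (hc : dilation_invariant Gamma).
Variables (m : R) (w : bcfun R).
Hypotheses (hw : classical_solution Gamma m w) (hw1 : `|w| <= 1).
Variables (u0 : bcfun R) (u : R -> bcfun R).
Hypothesis hu : cauchy_solution Gamma u0 u.
Variables (p C : R).
Hypotheses (p0 : 0 < p) (C0 : 0 <= C).
Hypothesis u0w : forall x, 0 <= x -> `|u0 x - w x| <= C * x `^ p.

Let phi (t : R) : bcfun R := expR t *: (u t - dilate (m * t) w).
Let l := fine (lambda K p).
Let l0 := fine (lambda K 0).

Let l_ge0 (q : R) : 0 <= q -> 0 <= fine (lambda K q).
Proof. by move=> q0; apply: fine_ge0; have /andP[/ltW] := hK _ q0. Qed.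

Let norm_u (t : R) : 0 <= t -> `|u t| <= 1.
Proof. by move=> t0; have [_ + _] := hu; exact. Qed.

Let norm_w (t : R) : `|dilate (m * t) w| <= 1.
Proof. exact: le_trans (norm_dilate_le _ _ _) hw1. Qed.

Let phi0 : phi 0 = u0 - w.
Proof.
have [u00 _ _] := hu; rewrite /phi expR0 scale1r mulr0 u00; congr (_ - _).
by apply: bcfunP => x _; rewrite dilateE expR0 mul1r.
Qed.

Let dphi (x t : R) : 0 < x -> 0 < t ->
  is_derive t 1 (fun s => phi s x)
    (expR t * (Gamma (u t) x - Gamma (dilate (m * t) w) x)).
Proof.
move=> x0 t0; have [_ _ [u' [du _ eu]]] := hu.
have duw := @is_deriveB _ _ _ _ _ _ _ _ _
  (is_derive_ge0_apply _ _ _ _ x t0 (du _ (ltW t0)))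
  (classical_solution_derive _ _ _ _ x t hc hw x0).
have := @is_deriveM _ _ _ _ _ _ _ _ (is_derive_expR t) duw.
move=> /is_derive_eq; apply.
rewrite -!(eu _ (ltW t0)) -![_ *: _]/(_ * _) bcfunDE !fctE; ring.
Qed.

Let cphi (x T : R) : 0 < x -> {within `[0, T], continuous (fun s => phi s x)}.
Proof.
move=> x0; have [_ _ [u' [du _ _]]] := hu.
have : {within `[0, +oo[, continuous (fun s => phi s x)}.
  apply/continuous_within_itvcyP; split.
    move=> t; rewrite in_itv/= andbT => t0.
    by have [/derivable1_diffP/differentiable_continuous] := dphi _ _ x0 t0.
  (* The exponential and the dilated profile are defined for all times and differentiable on both
     sides of 0, unlike [u]. *)
  have cd (f : R -> R) (a : R) : is_derive (0 : R) 1 f a -> f t @[t --> 0^'+] --> f 0.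
    case=> /derivable1_diffP/differentiable_continuous cf _.
    exact: cvg_at_right_filter.
  apply: cvgM; first exact: cd.
  apply: cvgB; first exact: is_derive_ge0_cvg0 (du _ (lexx _)).
  exact/cd/classical_solution_derive.
apply: continuous_subspaceW => t; rewrite /= !in_itv/= => /andP[->].
by [].
Qed.

(** The horizon [T] is fixed before the induction, so that the crude bound 2 e^T is constant in time
    and only [exp_coeff] gets integrated. *)
Let phi_iter (T : R) (n : nat) (t x : R) : 0 <= t -> t <= T -> 0 <= x ->
  `|phi t x| <= C * expR (l * t) * x `^ p + 2 * expR T * exp_coeff (l0 * t) n.
Proof.
elim: n t x => [|n IH] t x t0 tT.
  move=> x0; rewrite (_ : exp_coeff _ 0 = 1) ?mulr1; last first.
    by rewrite /exp_coeff /= expr0 fact0 divr1.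
  rewrite -[leLHS]add0r lerD ?mulr_ge0 ?expR_ge0 ?powR_ge0//.
  rewrite (le_trans (bcfun_ler_norm _ x0))// normrZ ger0_norm ?expR_ge0//.
  rewrite mulrC ler_pM ?expR_ge0// ?ler_expR//.
  by rewrite (le_trans (ler_normB _ _))// -[leRHS]/(1 + 1) lerD ?norm_u.
(* The induction hypothesis is needed for every [y >= 0], because L samples all dilates a x with a
   >= 0, whereas the differential inequality is available only at [x > 0]. *)
apply: bcfun_le_pow0 x => // x x0.
pose F (s : R) := C * x `^ p * expR (l * s) + 2 * expR T * exp_coeff (l0 * s) n.+1.
pose F' (s : R) := C * x `^ p * (l * expR (l * s)) +
  2 * expR T * (l0 * exp_coeff (l0 * s) n).
have dF (s : R) : is_derive s 1 F (F' s).
  by apply: is_deriveD; apply: is_deriveZ;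
    [exact: is_derive_expRM|exact: is_derive_exp_coeffM].
rewrite mulrAC -/(F t).
apply: (@le_norm_of_derive _ (fun s => phi s x) F _ F' T) => //.
- exact: cphi.
- by apply: derivable_within_continuous => s _; have [] := dF s.
- by move=> s s0; exact: dphi.
- move=> s s0 sT; rewrite normrM ger0_norm ?expR_ge0//.
  rewrite (le_trans (ler_wpM2l (expR_ge0 _) (hb _ _ (norm_u _ (ltW s0)) (norm_w _) x (ltW x0))))//.
  have ec0 : 0 <= exp_coeff (l0 * s) n.
    by rewrite exp_coeff_ge0// mulr_ge0 ?l_ge0// ltW.
  (* The Lipschitz bound involves the undamped difference, which is e^(-s) [phi s]; its majorant is
     the induction hypothesis multiplied by e^(-s). *)
  have A0 : 0 <= expR (- s) * (C * expR (l * s)) by rewrite !mulr_ge0 ?expR_ge0.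
  have B0 : 0 <= expR (- s) * (2 * expR T * exp_coeff (l0 * s) n).
    by rewrite mulr_ge0 ?expR_ge0// mulr_ge0// mulr_ge0 ?expR_ge0.
  have LE := @Lop_le _ K hK (u s - dilate (m * s) w) _ _ _ _ (ltW p0) x0 A0 B0.
  rewrite -(ler_pM2l (expR_gt0 (- s))) mulrA -expRD addNr expR0 mul1r.
  apply: le_trans (LE _) _ => [y y0|].
    have := IH s y (ltW s0) (ltW sT) y0.
    rewrite bcfunZE normrM ger0_norm ?expR_ge0//.
    rewrite -(ler_pM2l (expR_gt0 (- s))) mulrA -expRD addNr expR0 mul1r.
    by rewrite mulrDr !mulrA.
  by rewrite /F' le_eqVlt; apply/orP; left; apply/eqP; rewrite -/l -/l0; ring.
(* At time 0 the term of index [n.+1 > 0] vanishes, leaving exactly the assumed bound on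
   [u0 - w]. *)
- rewrite phi0 /F mulr0 expR0 mulr1 mulr0.
  rewrite (_ : exp_coeff 0 n.+1 = 0) ?mulr0 ?addr0; last first.
    by rewrite /exp_coeff /= expr0n mul0r.
  exact: u0w (ltW x0).
Qed.

Lemma dist_solution_le (t x : R) : 0 <= t -> 0 <= x ->
  `|u t x - w (expR (m * t) * x)| <= C * expR ((l - 1) * t) * x `^ p.
Proof.
move=> t0 x0.
(* Take the horizon [T = t] and let [n] tend to infinity. *)
have : `|phi t x| <= C * expR (l * t) * x `^ p + 2 * expR t * 0.
  apply: (@ler_cvg_to _ \oo _ _ (fun _ => `|phi t x|)
    (fun n => C * expR (l * t) * x `^ p + 2 * expR t * exp_coeff (l0 * t) n)).
  - exact: cvg_cst.
  - apply: cvgD; first exact: cvg_cst.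
    apply: cvgMl_tmp; exact: cvg_exp_coeff.
  - by near=> n; exact: phi_iter.
rewrite mulr0 addr0 bcfunZE normrM ger0_norm ?expR_ge0//.
rewrite -(ler_pM2l (expR_gt0 (- t))) mulrA -expRD addNr expR0 mul1r.
rewrite bcfunBE dilateE => /le_trans; apply.
rewrite mulrA [X in X * _]mulrCA -expRD.
by rewrite (_ : - t + l * t = (l - 1) * t)//; ring.
Unshelve. all: by end_near. Qed.

End convergence.

Theorem lemma6p4 (R : realType)
    (K : {finite_measure set (measurableTypeR R) -> \bar R})
    (hK : forall p : R, 0 <= p -> (0 < lambda K p < +oo)%E)
    (Gamma : bcfun R -> bcfun R)
    (ha : preserves_unit_ball Gamma)
    (hb : L_Lipschitz K Gamma)
    (hc : dilation_invariant Gamma)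
    (mustar : R) (w : bcfun R)
    (hw : classical_solution Gamma mustar w) (hw1 : `|w| <= 1)
    (u0 : bcfun R) (hu01 : `|u0| <= 1)
    (p : R) (hp : 0 < p) (hmu : mu K p < mustar)
    (hu0 : bigO_pow p (fun x => u0 x - w x))
    (u : R -> bcfun R) (hu : cauchy_solution Gamma u0 u) :
  (exists2 C : R, 0 < C & forall x t : R, 0 <= x -> 0 <= t ->
     `|u t (x * expR (- mustar * t)) - w x|
       <= C * x `^ p * expR (- p * t * (mustar - mu K p))) /\
  (forall x : R, 0 <= x -> u t (x * expR (- mustar * t)) @[t --> +oo] --> w x).
Proof.
have [C C0 u0w] := hu0.
have bound x t : 0 <= x -> 0 <= t -> `|u t (x * expR (- mustar * t)) - w x|
    <= C * x `^ p * expR (- p * t * (mustar - mu K p)).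
  move=> x0 t0.
  have := @dist_solution_le _ K hK Gamma hb hc mustar w hw hw1 u0 u hu p C hp
    (ltW C0) u0w t (x * expR (- mustar * t)) t0 (mulr_ge0 x0 (expR_ge0 _)).
  rewrite mulrCA -expRD mulNr subrr expR0 mulr1 => /le_trans; apply.
  rewrite powRM ?expR_ge0// -expRM -[leLHS]mulrA [X in _ * X]mulrCA -expRD mulrA.
  (* The exponents combine because p mu(p) = lambda(p) - 1. *)
  rewrite (_ : _ + _ = - p * t * (mustar - mu K p))//.
  by rewrite /mu; field; rewrite gt_eqF.
split; first by exists C.
move=> x x0; apply/cvgrPdist_le => e e0.
(* The decay rate, positive because mu(p) < mustar. *)
pose c := p * (mustar - mu K p).
have c0 : 0 < c by rewrite mulr_gt0// subr_gt0.
have lim0 : C * x `^ p * expR (- (c * t)) @[t --> +oo] --> (0 : R).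
  rewrite -[X in _ --> X](mulr0 (C * x `^ p)).
  apply: cvgMl_tmp.
  apply: (@cvg_comp _ _ _ (fun t => c * t) (fun t => expR (- t)) _ _ _ _ (@cvgr_expR R)).
  exact: gt0_cvgMry.
move/cvgrPdist_le : lim0 => /(_ _ e0) lim0.
near=> t; rewrite distrC (le_trans (bound _ _ _ _))//.
have : `|0 - C * x `^ p * expR (- (c * t))| <= e by near: t.
rewrite sub0r normrN ger0_norm ?mulr_ge0 ?expR_ge0 ?powR_ge0 ?(ltW C0)//.
rewrite (_ : - (c * t) = - p * t * (mustar - mu K p))//.
by rewrite /c; ring.
Unshelve. all: by end_near. Qed.
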